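(* For every integer $m \geq 1$, there exist infinitely many $\{0,m\}$-perfect numbers.
   Context: Let $\mathcal{S} \subset \mathbb{Z}$. An integer $n > 1$ with positive divisors $1 = d_0 < d_1 < \cdots < d_r < d_{r+1} = n$ is called $\mathcal{S}$-perfect (of the first kind) if there exist $\lambda_1, \ldots, \lambda_r \in \mathcal{S}$ (not necessarily distinct) such that $1+\sum_{j=1}^{r}\lambda_j d_j = n$. (The divisor $1$ always has coefficient $1$, and every divisor $d$ with $1<d<n$ must receive a coefficient from $\mathcal{S}$.) *)

(* Defs.v *)
From mathcomp Require Export all_boot all_order all_algebra.
From mathcomp Require Export classical_sets cardinality.
Set Implicit Arguments.
Unset Strict Implicit.
Unset Printing Implicit Defensive.
Import Order.TTheory GRing.Theory Num.Theory.

Local Open Scope ring_scope.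

(* The coefficients are indexed by the divisors d_j themselves rather than by
   j; values of [lambda] outside the divisors 1 < d < n are irrelevant. *)
Definition S_perfect (S : set int) (n : nat) : Prop :=
  (1 < n)%N /\
  exists lambda : nat -> int,
    (forall d : nat, (d %| n)%N -> (1 < d < n)%N -> S (lambda d)) /\
    1 + \sum_(d <- divisors n | (1 < d < n)%N) lambda d * d%:Z = n%:Z.

(* Main.v *)
(* In terms of natural numbers, [n] is {0, m}-perfect when [n = 1 + m * sum s]
   for some list [s] of distinct divisors [1 < d < n].  Since
   (m + 1)(m^2 + m + 1) = 1 + m ((m + 1) + (m^2 + m + 1)), the number
   (m + 1)(m^2 + m + 1) is such an [n].  If [n] is, so is [n * q] with
   [q = 1 + m n]: indeed [n q = q + m (q sum s) = 1 + m (n + q sum s)], and the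
   divisor [n < q] differs from every [q d]. *)
Require Import Defs.
From mathcomp Require Import all_boot all_order all_algebra.
From mathcomp Require Import classical_sets cardinality.
From mathcomp Require Import zify.
Import GRing.Theory.

Local Open Scope classical_set_scope.
Local Open Scope ring_scope.

Definition perfect_witness (k n : nat) (s : seq nat) : Prop :=
  [/\ uniq s, {in s, forall d, (d %| n)%N && (1 < d < n)%N}
    & n = (1 + k * \sum_(d <- s) d)%N].

(** Give the divisors in [s] the coefficient [k] and all others 0; only [s] then contributes to the
    sum. *)
Lemma perfect_witness_S_perfect (k n : nat) (s : seq nat) :
  (1 < n)%N -> perfect_witness k n s -> S_perfect [set 0; k%:Z] n.
Proof.
move=> n_gt1 [s_uniq s_div n_eq]; split=> //.
exists (fun d => if d \in s then k%:Z else 0); split.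
  by move=> d _ _; case: ifP => _; [right | left].
transitivity (1 + k%:Z * (\sum_(d <- s) d)%:Z); last lia.
congr (_ + _).
(* The order of [s] is arbitrary, so it agrees with the divisors selected by it only up to
   permutation. *)
have s_perm : perm_eq [seq d <- divisors n | (d \in s) && (1 < d < n)%N] s.
  apply: uniq_perm => // [|d]; first by rewrite filter_uniq ?divisors_uniq.
  rewrite mem_filter -dvdn_divisors ?(ltnW n_gt1) //.
  by case: (boolP (d \in s)) => //= /s_div; rewrite andbC.
rewrite -(perm_big _ s_perm) /= big_filter (big_morph Posz PoszD (erefl _)).
rewrite mulr_sumr (bigID (mem s)) /= [X in _ + X]big1 ?addr0.
  rewrite (eq_bigl (fun d => (d \in s) && (1 < d < n)%N)) => [|d]; last exact: andbC.
  by apply: eq_bigr => d /andP[-> _].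
by move=> d /andP[_ /negPf ->]; rewrite mul0r.
Qed.

Lemma perfect_witness_base (k : nat) : (0 < k)%N ->
  perfect_witness k (k.+1 * (k ^ 2 + k + 1)) [:: k.+1; (k ^ 2 + k + 1)%N].
Proof.
move=> k_gt0; split=> [|d|].
(* The two divisors differ by [k ^ 2 > 0]. *)
- by rewrite /= inE andbT; nia.
- rewrite !inE -mulnn => /orP[] /eqP ->.
    by rewrite dvdn_mulr //=; nia.
  by rewrite dvdn_mull //=; nia.
- by rewrite !big_cons big_nil -mulnn; lia.
Qed.

Lemma perfect_witness_step (k n : nat) (s : seq nat) :
  (0 < k)%N -> (1 < n)%N -> perfect_witness k n s ->
  perfect_witness k (n * (1 + k * n))
    (n :: [seq ((1 + k * n) * d)%N | d <- s]).
Proof.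
move=> k_gt0 n_gt1 [s_uniq s_div n_eq]; split=> [|d|].
- have q_gt : (n < 1 + k * n)%N by nia.
  rewrite /= map_inj_uniq ?s_uniq ?andbT => [|x y /eqP]; last first.
    by rewrite eqn_pmul2l // => /eqP.
  (* If [n = q * d] with [q = 1 + k * n] and [d] positive, then [q <= n], contradicting [n < q]. *)
  apply/mapP => -[d /s_div /and3P[_ d_gt1 _] n_eqM].
  by have := leq_pmulr (1 + k * n) (ltnW d_gt1); rewrite -n_eqM leqNgt q_gt.
- rewrite inE => /predU1P[-> | /mapP[e /s_div /and3P[e_dvd e_gt1 e_lt] ->]].
    by rewrite dvdn_mulr //=; nia.
  by rewrite mulnC dvdn_mul //= ltn_pmul2r // e_lt andbT; nia.
- rewrite big_cons big_map -big_distrr /=.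
  by have := congr1 (muln (1 + k * n)) n_eq; lia.
Qed.

(** Each step replaces [n] by [n * (1 + k * n) > n], so iterating from the base number passes every
    bound. *)
Lemma perfect_witness_unbounded (k N : nat) : (0 < k)%N ->
  exists n s, [/\ (N < n)%N, (1 < n)%N & perfect_witness k n s].
Proof.
move=> k_gt0; elim: N => [|N [n [s [N_lt n_gt1 n_wit]]]].
  by do 2!eexists; split; last exact: perfect_witness_base; nia.
by do 2!eexists; split; last exact: perfect_witness_step n_wit; nia.
Qed.

Lemma unbounded_infinite_set (A : set nat) :
  (forall N, exists2 n, (N < n)%N & A n) -> infinite_set A.
Proof.
move=> A_unb /finite_seqP[s A_eq].
(* An element beyond the maximum of a finite enumeration cannot occur in it. *)
have [n n_gt] := A_unb (\max_(i <- s) i)%N.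
by rewrite A_eq /= => n_s; move: n_gt; rewrite ltnNge leq_bigmax_seq.
Qed.

Theorem theorem6 (m : int) (hm : 1 <= m) :
  infinite_set [set n : nat | S_perfect [set 0; m] n].
Proof.
case: m hm => // k k_gt0; apply: unbounded_infinite_set => N.
have [n [s [N_lt n_gt1 n_wit]]] := perfect_witness_unbounded k N k_gt0.
by exists n => //; apply: perfect_witness_S_perfect n_wit.
Qed.
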